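(* Let $(M,\varphi,\xi,\eta,g)$ be a $3$-dimensional trans-Sasakian manifold of type $(\alpha,\beta)$ equipped with a Newman--Penrose frame $(\partial,\overline{\partial},\xi)$. Then the rough Laplacian of the vector field $\xi$ is given by $$\Delta_g\xi=-\overline{\partial}(\overline{\rho_{\mathrm{np}}})\,\partial-\partial(\rho_{\mathrm{np}})\,\overline{\partial}+2|\rho_{\mathrm{np}}|^2\,\xi.$$
   Context: An almost contact metric structure $(\varphi,\xi,\eta,g)$ on $M$: $\varphi$ a $(1,1)$-tensor, $\xi$ a vector field, $\eta$ a $1$-form, $g$ a Riemannian metric with $\varphi^2=-I+\eta\otimes\xi$, $\eta(\xi)=1$, $\varphi\xi=0$, $\eta\circ\varphi=0$, $g(\varphi X,\varphi Y)=g(X,Y)-\eta(X)\eta(Y)$. It is trans-Sasakian of type $(\alpha,\beta)$ ($\alpha,\beta$ smooth functions) if $(\nabla_X\varphi)Y=\alpha(g(X,Y)\xi-\eta(Y)X)+\beta(g(\varphi X,Y)\xi-\eta(Y)\varphi X)$, with $\nabla$ the Levi-Civita connection. Newman--Penrose frame: for an orthonormal frame $(e_1,e_2,\xi)$, put $\partial=\frac1{\sqrt2}(e_1-ie_2)$, $\overline{\partial}=\frac1{\sqrt2}(e_1+ie_2)$, chosen so that $\varphi\partial=i\partial$, $\varphi\overline{\partial}=-i\overline{\partial}$ (i.e. $\varphi e_1=e_2$). All tensors and $\nabla$ are extended complex-(multi)linearly. Put $\sigma_{\mathrm{np}}=-g(\partial,\nabla_\partial\xi)$, $\rho_{\mathrm{np}}=g(\partial,\nabla_{\overline{\partial}}\xi)$,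 $\kappa_{\mathrm{np}}=-g(\partial,\nabla_\xi\xi)$. In these terms the trans-Sasakian condition of type $(\alpha,\beta)$ reads $\kappa_{\mathrm{np}}=\sigma_{\mathrm{np}}=0$, $\rho_{\mathrm{np}}=\beta+i\alpha$. For a function $f$, $\partial(f),\overline{\partial}(f)$ denote derivatives along these vector fields. Rough Laplacian of a vector field $X$ (with $e_3=\xi$): $\Delta_gX=-\sum_{i=1}^3\bigl(\nabla_{e_i}\nabla_{e_i}X-\nabla_{\nabla_{e_i}e_i}X\bigr)$. *)

(* Defs.v *)
From HB Require Import structures.
From mathcomp Require Import all_boot all_order all_algebra.
From mathcomp Require Import ring.
From mathcomp Require Import all_classical all_reals all_analysis.

Set Implicit Arguments.
Unset Strict Implicit.
Unset Printing Implicit Defensive.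

Import Order.TTheory GRing.Theory Num.Theory.
Import numFieldNormedType.Exports.

Local Open Scope classical_set_scope.
Local Open Scope ring_scope.

(* Smooth functions on an open subset of R^n, through iterated partial        *)
(* derivatives along the standard basis [delta_mx 0 i].                       *)
Section EuclideanSmooth.
Context {R : realType} {n : nat}.
Implicit Types (U : set 'rV[R]_n) (f g : 'rV[R]_n -> R).

Fixpoint is_Ck (k : nat) U f : Prop :=
  (forall x, U x -> {for x, continuous f}) /\
  match k with
  | 0%N => True
  | k'.+1 => forall i : 'I_n,
      (forall x, U x -> derivable f x (delta_mx 0 i)) /\
      is_Ck k' U (fun x => 'D_(delta_mx 0 i) f x)
  end.

Definition is_smooth_on U f : Prop := forall k, is_Ck k U f.

Lemma is_Ck_ext k U f g : open U -> (forall x, U x -> f x = g x) ->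
  is_Ck k U f -> is_Ck k U g.
Proof.
move=> Uo.
have near_fg (f' g' : 'rV[R]_n -> R) x : (forall x, U x -> f' x = g' x) ->
    U x -> {near x, f' =1 g'}.
  by move=> fg Ux; apply: filterS fg (open_nbhs_nbhs _).
have gc (f' g' : 'rV[R]_n -> R) x : (forall x, U x -> f' x = g' x) ->
    U x -> {for x, continuous f'} -> {for x, continuous g'}.
  move=> fg Ux; rewrite /prop_for /continuous_at (fg _ Ux).
  apply: cvg_trans; refine (@near_eq_cvg _ _ (nbhs x) (nbhs_filter x) _ _ _).
  exact: near_fg fg Ux.
elim: k f g => [|k IH] f g fg [fc fd].
  by split=> // x Ux; exact: gc (fc _ Ux).
split=> [x Ux|i]; first exact: gc (fc _ Ux).
have [fdi fDi] := fd i; split=> [x Ux|].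
  exact: near_eq_derivable (near_fg _ _ _ fg Ux) (fdi _ Ux).
apply: IH fDi => x Ux; apply: near_eq_derive; exact: near_fg Ux.
Qed.

Lemma is_CkW k U f : is_Ck k.+1 U f -> is_Ck k U f.
Proof.
elim: k f => [|k IH] f [fc fd]; first by split.
by split=> // i; have [fdi fDi] := fd i; split=> //; exact: IH.
Qed.

Lemma is_Ck_cst k U (a : R) : is_Ck k U (cst a).
Proof.
elim: k a => [|k IH] a /=; split=> //; try by move=> x _; apply: cst_continuous.
move=> i; split=> [x _|]; first exact: (derivable_cst a x (delta_mx 0 i)).
have -> : (fun x : 'rV[R]_n => 'D_(delta_mx 0 i) (cst a) x) = cst 0.
  by apply/funext => x; rewrite derive_cst.
exact: IH.
Qed.

Lemma is_CkD k U f g : open U ->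
  is_Ck k U f -> is_Ck k U g -> is_Ck k U (f + g).
Proof.
move=> Uo; elim: k f g => [|k IH] f g [fc fd] [gc gd].
  by split=> // x Ux; exact: continuousD (fc _ Ux) (gc _ Ux).
split=> [x Ux|i]; first exact: continuousD (fc _ Ux) (gc _ Ux).
have [fdi fDi] := fd i; have [gdi gDi] := gd i; split=> [x Ux|].
  exact: derivableD (fdi _ Ux) (gdi _ Ux).
apply: is_Ck_ext (IH _ _ fDi gDi) => // x Ux.
by rewrite deriveD //; [exact: fdi|exact: gdi].
Qed.

Lemma is_CkM k U f g : open U ->
  is_Ck k U f -> is_Ck k U g -> is_Ck k U (f * g).
Proof.
move=> Uo; elim: k f g => [|k IH] f g fk gk; have [fc fd] := fk;
    have [gc gd] := gk.
  by split=> // x Ux; exact: continuousM (fc _ Ux) (gc _ Ux).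
split=> [x Ux|i]; first exact: continuousM (fc _ Ux) (gc _ Ux).
have [fdi fDi] := fd i; have [gdi gDi] := gd i; split=> [x Ux|].
  exact: derivableM (fdi _ Ux) (gdi _ Ux).
apply: is_Ck_ext (is_CkD Uo (IH _ _ (is_CkW fk) gDi) (IH _ _ (is_CkW gk) fDi)).
  by [].
by move=> x Ux; rewrite deriveM //; [exact: fdi|exact: gdi].
Qed.

End EuclideanSmooth.

Record chart (R : realType) (n : nat) (T : topologicalType) := Chart {
  chart_dom : set T;
  chart_cod : set 'rV[R]_n;
  chart_map : T -> 'rV[R]_n;
  chart_inv : 'rV[R]_n -> T;
  chart_dom_open : open chart_dom;
  chart_cod_open : open chart_cod;
  chart_map_cod : forall x, chart_dom x -> chart_cod (chart_map x);
  chart_inv_dom : forall y, chart_cod y -> chart_dom (chart_inv y);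
  chart_mapK : forall x, chart_dom x -> chart_inv (chart_map x) = x;
  chart_invK : forall y, chart_cod y -> chart_map (chart_inv y) = y;
  chart_map_continuous :
    forall x, chart_dom x -> {for x, continuous chart_map};
  chart_inv_continuous :
    forall y, chart_cod y -> {for y, continuous chart_inv}
}.

(* The transition map [d o c^-1] is smooth on [c (dom c `&` dom d)].          *)
Definition chart_compatible (R : realType) (n : nat) (T : topologicalType)
    (c d : chart R n T) : Prop :=
  forall i : 'I_n,
    is_smooth_on (chart_cod c `&` chart_inv c @^-1` chart_dom d)
      (fun y => chart_map d (chart_inv c y) 0 i).

Record manifold (R : realType) (n : nat) := Manifold {
  manifold_carrier :> topologicalType;
  manifold_hausdorff : hausdorff_space manifold_carrier;
  manifold_second_countable : @second_countable manifold_carrier;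
  manifold_atlas : set (chart R n manifold_carrier);
  manifold_cover : forall p, exists2 c, manifold_atlas c & chart_dom c p;
  manifold_compatible : forall c d,
    manifold_atlas c -> manifold_atlas d -> chart_compatible c d
}.

(* C^oo(M), as a commutative ring (the zero ring when M is empty).            *)
Section SmoothFunctions.
Context {R : realType} {n : nat}.
Variable M : manifold R n.

Definition smooth_on_manifold (f : M -> R) : Prop :=
  forall c, manifold_atlas c -> is_smooth_on (chart_cod c) (f \o chart_inv c).

Definition smooth_pred : {pred M -> R} :=
  [pred f | `[< smooth_on_manifold f >]].

Lemma smooth_subring_closed : subring_closed smooth_pred.
Proof.
have cstP a : cst a \in smooth_pred.
  by apply/asboolP => c _ k; exact: is_Ck_cst.
have mulP f g : f \in smooth_pred -> g \in smooth_pred ->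
    f * g \in smooth_pred.
  move=> /asboolP fs /asboolP gs; apply/asboolP => c Mc k.
  exact: (is_CkM (@chart_cod_open _ _ _ c) (fs c Mc k) (gs c Mc k)).
split=> [|f g fs gs|f g]; [exact: cstP| |exact: mulP].
have /asboolP gs' : - g \in smooth_pred.
  by rewrite -mulN1r; apply: mulP => //; exact: (cstP (- 1)).
move/asboolP: fs => fs; apply/asboolP => c Mc k.
exact: (is_CkD (@chart_cod_open _ _ _ c) (fs c Mc k) (gs' c Mc k)).
Qed.

Record smooth_fun := SmoothFun {
  smooth_val :> M -> R;
  smooth_valP : smooth_val \in smooth_pred
}.

HB.instance Definition _ := [isSub for smooth_val].
HB.instance Definition _ := [Choice of smooth_fun by <:].
HB.instance Definition _ := GRing.SubChoice_isSubComPzRing.Build _ _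
  smooth_fun smooth_subring_closed.

Lemma smooth_cstP (a : R) : cst a \in smooth_pred.
Proof. by apply/asboolP => c _ k; exact: is_Ck_cst. Qed.

Definition smooth_cst (a : R) : smooth_fun := SmoothFun (smooth_cstP a).

End SmoothFunctions.

Notation "'C^oo' ( M )" := (smooth_fun M) (at level 8, format "'C^oo' ( M )").

(* Vector fields are the R-linear derivations of C^oo(M); they form a         *)
(* C^oo(M)-module.                                                            *)
Section VectorFields.
Context {R : realType} {n : nat}.
Variable M : manifold R n.

Definition is_derivation (X : C^oo(M) -> C^oo(M)) : Prop :=
  [/\ forall f h, X (f + h) = X f + X h,
      forall (a : R) f, X (smooth_cst M a * f) = smooth_cst M a * X f &
      forall f h, X (f * h) = f * X h + h * X f].

Definition derivation_pred : {pred C^oo(M) -> C^oo(M)^o} :=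
  [pred X | `[< is_derivation X >]].

Lemma derivation_submod_closed : submod_closed derivation_pred.
Proof.
split=> [|a X Y /asboolP[XD XZ XM] /asboolP[YD YZ YM]]; apply/asboolP.
  split=> [f h|c f|f h]; rewrite [LHS]/(0 : C^oo(M)).
  - by rewrite [X in _ = X]addr0.
  - by rewrite [X in _ = X]mulr0.
  - by rewrite [X in _ = X + _]mulr0 add0r [X in _ = X]mulr0.
have E f : (a *: X + Y) f = a * X f + Y f :> C^oo(M) by [].
split=> [f h|c f|f h]; rewrite !E.
- by rewrite XD YD; ring.
- by rewrite XZ YZ; ring.
- by rewrite XM YM; ring.
Qed.

Record vector_field := VectorField {
  vf_val :> C^oo(M) -> C^oo(M)^o;
  vf_valP : vf_val \in derivation_pred
}.

HB.instance Definition _ := [isSub for vf_val].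
HB.instance Definition _ := [Choice of vector_field by <:].
HB.instance Definition _ := GRing.SubChoice_isSubLmodule.Build _ _ _
  vector_field derivation_submod_closed.

Lemma lie_bracketP (X Y : vector_field) :
  (fun f => X (Y f) - Y (X f)) \in derivation_pred.
Proof.
case: X Y => X /= /asboolP[XD XZ XM] [Y /= /asboolP[YD YZ YM]].
apply/asboolP; split=> [f h|c f|f h].
- by rewrite YD XD XD YD; ring.
- by rewrite YZ XZ XZ YZ; ring.
- by rewrite YM XM XD YD !XM !YM; ring.
Qed.

Definition lie_bracket (X Y : vector_field) : vector_field :=
  VectorField (lie_bracketP X Y).

End VectorFields.

(* Complexification V (x) C of a module V; the pair (x, y) stands for x + iy. *)
Definition cplx (V : Type) : Type := (V * V)%type.

HB.instance Definition _ (V : zmodType) := GRing.Zmodule.copy (cplx V) (V * V)%type.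

Section ComplexRing.
Variable A : comPzRingType.

Definition cplx_one : cplx A := (1, 0).
Definition cplx_mul (z w : cplx A) : cplx A :=
  (z.1 * w.1 - z.2 * w.2, z.1 * w.2 + z.2 * w.1).

Lemma cplx_mulA : associative cplx_mul.
Proof. by move=> [a b] [c d] [e f]; congr pair => /=; ring. Qed.
Lemma cplx_mulC : commutative cplx_mul.
Proof. by move=> [a b] [c d]; congr pair => /=; ring. Qed.
Lemma cplx_mul1 : left_id cplx_one cplx_mul.
Proof. by move=> [a b]; congr pair => /=; ring. Qed.
Lemma cplx_mulDl : left_distributive cplx_mul +%R.
Proof. by move=> [a b] [c d] [e f]; congr pair => /=; ring. Qed.

HB.instance Definition _ := GRing.Zmodule_isComPzRing.Build (cplx A)
  cplx_mulA cplx_mulC cplx_mul1 cplx_mulDl.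

Definition cplx_i : cplx A := (0, 1).
Definition cplx_conj (z : cplx A) : cplx A := (z.1, - z.2).
Definition cplx_normsq (z : cplx A) : A := z.1 ^+ 2 + z.2 ^+ 2.

End ComplexRing.

Section ComplexModule.
Variables (A : comPzRingType) (V : lmodType A).

Definition cplx_scale (z : cplx A) (v : cplx V) : cplx V :=
  (z.1 *: v.1 - z.2 *: v.2, z.1 *: v.2 + z.2 *: v.1).

Lemma cplx_scaleA z w v :
  cplx_scale z (cplx_scale w v) = cplx_scale (z * w) v.
Proof.
case: z w v => [a b] [c d] [x y]; congr pair => /=;
  rewrite !(scalerDr, scalerDl, scalerN, scaleNr) !scalerA ?opprD ?opprK;
  by rewrite -!addrA; congr (_ + _); rewrite addrA addrC.
Qed.
Lemma cplx_scale1 : left_id 1 cplx_scale.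
Proof.
by case=> x y; congr pair; rewrite /= !scale1r !scale0r ?subr0 ?addr0.
Qed.
Lemma cplx_scaleDr : right_distributive cplx_scale +%R.
Proof.
case=> [a b] [x y] [u v]; congr pair => /=; rewrite !scalerDr.
  by rewrite opprD addrACA.
by rewrite addrACA.
Qed.
Lemma cplx_scaleDl v : {morph cplx_scale^~ v : z w / z + w}.
Proof.
case: v => [x y] [a b] [c d]; congr pair => /=; rewrite !scalerDl.
  by rewrite opprD addrACA.
by rewrite addrACA.
Qed.

HB.instance Definition _ := GRing.Zmodule_isLmodule.Build (cplx A) (cplx V)
  cplx_scaleA cplx_scale1 cplx_scaleDr cplx_scaleDl.

End ComplexModule.

Definition cplx_of (V : zmodType) (v : V) : cplx V := (v, 0).

(* Complex-(bi)linear extension of real (bi)linear maps.                      *)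
Definition cplx_ext (V W : Type) (L : V -> W) (z : cplx V) : cplx W :=
  (L z.1, L z.2).
Definition cplx_ext2 (U V : Type) (W : zmodType) (B : U -> V -> W)
    (z : cplx U) (w : cplx V) : cplx W :=
  (B z.1 w.1 - B z.2 w.2, B z.1 w.2 + B z.2 w.1).

Section Riemannian.
Context {R : realType} {n : nat} {M : manifold R n}.
Implicit Types (f : C^oo(M)) (X Y Z : vector_field M).

(* [X p != 0] as a tangent vector when [X h p != 0] for some function h.      *)
Record riemannian_metric (g : vector_field M -> vector_field M -> C^oo(M)) :
    Prop := RiemannianMetric {
  metric_sym : forall X Y, g X Y = g Y X;
  metric_linear : forall f X Y Z, g (f *: X + Y) Z = f * g X Z + g Y Z;
  metric_pos : forall X (p : M),
    (exists h : C^oo(M), (X h : C^oo(M)) p != 0) -> 0 < g X X p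
}.

Record affine_connection
    (nabla : vector_field M -> vector_field M -> vector_field M) :
    Prop := AffineConnection {
  connection_linear : forall f X Y Z,
    nabla (f *: X + Y) Z = f *: nabla X Z + nabla Y Z;
  connection_additive : forall X Y Z,
    nabla X (Y + Z) = nabla X Y + nabla X Z;
  connection_leibniz : forall f X Y,
    nabla X (f *: Y) = X f *: Y + f *: nabla X Y
}.

Record levi_civita (g : vector_field M -> vector_field M -> C^oo(M))
    (nabla : vector_field M -> vector_field M -> vector_field M) :
    Prop := LeviCivita {
  levi_civita_connection : affine_connection nabla;
  levi_civita_torsion_free : forall X Y,
    nabla X Y - nabla Y X = lie_bracket X Y;
  levi_civita_metric : forall X Y Z,
    X (g Y Z) = g (nabla X Y) Z + g Y (nabla X Z)
}.

(* A frame is a basis of the C^oo(M)-module of vector fields.                 *)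
Definition is_frame (e : 'I_n -> vector_field M) : Prop :=
  forall X, exists! c : 'I_n -> C^oo(M), X = \sum_i c i *: e i.

Definition orthonormal_frame
    (g : vector_field M -> vector_field M -> C^oo(M))
    (e : 'I_n -> vector_field M) : Prop :=
  is_frame e /\ forall i j, g (e i) (e j) = (i == j)%:R.

Definition rough_laplacian
    (nabla : vector_field M -> vector_field M -> vector_field M)
    (e : 'I_n -> vector_field M) X : vector_field M :=
  - \sum_i (nabla (e i) (nabla (e i) X) - nabla (nabla (e i) (e i)) X).

Record almost_contact_metric
    (phi : {linear vector_field M -> vector_field M})
    (xi : vector_field M)
    (eta : {linear vector_field M -> C^oo(M)^o})
    (g : vector_field M -> vector_field M -> C^oo(M)) :
    Prop := AlmostContactMetric {
  acm_metric : riemannian_metric g;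
  acm_phi2 : forall X, phi (phi X) = - X + eta X *: xi;
  acm_eta_xi : eta xi = 1;
  acm_phi_xi : phi xi = 0;
  acm_eta_phi : forall X, eta (phi X) = 0;
  acm_compatible : forall X Y, g (phi X) (phi Y) = g X Y - eta X * eta Y
}.

(* The left-hand side is [(nabla_X phi) Y]; [nabla] is meant to be the        *)
(* Levi-Civita connection of [g].                                             *)
Definition trans_sasakian
    (phi : {linear vector_field M -> vector_field M})
    (xi : vector_field M)
    (eta : {linear vector_field M -> C^oo(M)^o})
    (g : vector_field M -> vector_field M -> C^oo(M))
    (nabla : vector_field M -> vector_field M -> vector_field M)
    (alpha beta : C^oo(M)) : Prop :=
  forall X Y, nabla X (phi Y) - phi (nabla X Y) =
    alpha *: (g X Y *: xi - eta Y *: X) +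
    beta *: (g (phi X) Y *: xi - eta Y *: phi X).

(* The derivative of the complex function f along the complex field Z.        *)
Definition cplx_derive (Z : cplx (vector_field M)) (f : cplx C^oo(M)) :
    cplx C^oo(M) :=
  cplx_ext2 (fun X h => X h : C^oo(M)) Z f.

(* The complex vector fields (e1 -+ i e2) / sqrt 2.                           *)
Definition np_del (e1 e2 : vector_field M) : cplx (vector_field M) :=
  cplx_of (smooth_cst M (Num.sqrt 2)^-1) *:
    (cplx_of e1 - cplx_i C^oo(M) *: cplx_of e2).
Definition np_delbar (e1 e2 : vector_field M) : cplx (vector_field M) :=
  cplx_of (smooth_cst M (Num.sqrt 2)^-1) *:
    (cplx_of e1 + cplx_i C^oo(M) *: cplx_of e2).

Definition np_rho (g : vector_field M -> vector_field M -> C^oo(M))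
    (nabla : vector_field M -> vector_field M -> vector_field M)
    (e1 e2 xi : vector_field M) : cplx C^oo(M) :=
  cplx_ext2 g (np_del e1 e2)
    (cplx_ext2 nabla (np_delbar e1 e2) (cplx_of xi)).

End Riemannian.

Section NewmanPenrose.
Context {R : realType} {M : manifold R 3}.

Definition frame3 (e1 e2 e3 : vector_field M) : 'I_3 -> vector_field M :=
  fun i => [:: e1; e2; e3]`_i.

Record np_frame (phi : {linear vector_field M -> vector_field M})
    (xi : vector_field M)
    (g : vector_field M -> vector_field M -> C^oo(M))
    (e1 e2 : vector_field M) : Prop := NPFrame {
  np_orthonormal : orthonormal_frame g (frame3 e1 e2 xi);
  np_phi_del : cplx_ext phi (np_del e1 e2) =
    cplx_i C^oo(M) *: np_del e1 e2;
  np_phi_delbar : cplx_ext phi (np_delbar e1 e2) =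
    - cplx_i C^oo(M) *: np_delbar e1 e2
}.

End NewmanPenrose.

(* Main.v *)
Require Import Defs.
From HB Require Import structures.
From mathcomp Require Import all_boot all_order all_algebra.
From mathcomp Require Import ring.
From mathcomp Require Import all_classical all_reals all_analysis.

Set Implicit Arguments.
Unset Strict Implicit.
Unset Printing Implicit Defensive.

Import Order.TTheory GRing.Theory Num.Theory.
Import numFieldNormedType.Exports.

Local Open Scope classical_set_scope.
Local Open Scope ring_scope.

(** Differentiating [phi xi = 0] gives the structure equation
    [nabla_X xi = beta (X - eta(X) xi) - alpha phi X], so that [rho = beta + i alpha].
    Differentiating it once more along a unit [X] orthogonal to [xi] expresses
    [nabla^2_{X,X} xi] through [X(alpha)] and [X(beta)]; the direction [xi] does
    not contribute, because [nabla_xi xi = 0].  Summing over [e1] and [e2]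
    gives the Laplacian in the real frame, and it remains to expand the
    complex derivatives of [rho].  Since the metric is nondegenerate, vector
    identities are checked by pairing both sides with an arbitrary field. *)

(** * Vector fields acting on smooth functions *)

Section ScalarFunctions.
Context {R : realType} {n : nat} {M : manifold R n}.
Implicit Types (f h : C^oo(M)) (X Y : vector_field M).

Lemma vfM X f h : X (f * h) = f * (X h : C^oo(M)) + h * (X f : C^oo(M)) :> C^oo(M).
Proof. by case: X => X /= /asboolP[_ _ XM]; exact: XM. Qed.

Lemma vf0 X : X 0 = 0 :> C^oo(M).
Proof. by have := vfM X 0 0; rewrite !mul0r addr0. Qed.

Lemma vf1 X : X 1 = 0 :> C^oo(M).
Proof.
have := vfM X 1 1; rewrite !mul1r => h.
by apply: (@addrI (C^oo(M)) (X 1)); rewrite addr0.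
Qed.

Lemma vfN X f : X (- f) = - (X f : C^oo(M)) :> C^oo(M).
Proof.
apply: (@addIr (C^oo(M)) (X f)); rewrite addNr -(vf0 X).
by case: X => X /= /asboolP[XD _ _]; rewrite -XD addNr.
Qed.

Lemma vfNl X f : (- X) f = - (X f : C^oo(M)) :> C^oo(M).
Proof. by []. Qed.

Lemma vfZl X f h : (f *: X) h = f * (X h : C^oo(M)) :> C^oo(M).
Proof. by []. Qed.

Lemma cplx_deriveE X Y f h :
  cplx_derive (X, Y) (f, h) =
  ((X f : C^oo(M)) - (Y h : C^oo(M)), (X h : C^oo(M)) + (Y f : C^oo(M))).
Proof. by []. Qed.

Lemma smooth_ext f h : (forall p, f p = h p) -> f = h.
Proof. by move=> fh; apply: val_inj; apply/funext. Qed.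

Lemma smooth_cstM (a b : R) :
  smooth_cst M a * smooth_cst M b = smooth_cst M (a * b).
Proof. exact: smooth_ext. Qed.

(** Checked pointwise, where the values lie in a field of characteristic zero. It serves to conclude
    from antisymmetry. *)
Lemma smooth_addff_eq0 f : f + f = 0 -> f = 0.
Proof.
move=> f2; apply: smooth_ext => p.
have : f p + f p = 0 by rewrite -[LHS]/((f + f) p) f2.
by move/eqP; rewrite -mulr2n mulrn_eq0 => /eqP.
Qed.

End ScalarFunctions.

(** * Bilinearity and nondegeneracy of the metric *)

Section Metric.
Context {R : realType} {n : nat} {M : manifold R n}.
Variable g : vector_field M -> vector_field M -> C^oo(M).
Hypothesis gm : riemannian_metric g.
Implicit Types (f : C^oo(M)) (X Y Z : vector_field M).

Lemma metricDl X Y Z : g (X + Y) Z = g X Z + g Y Z.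
Proof. by have := metric_linear gm 1 X Y Z; rewrite scale1r mul1r. Qed.
Lemma metric0l Z : g 0 Z = 0.
Proof. by apply: (@addrI _ (g 0 Z)); rewrite -metricDl !addr0. Qed.
Lemma metricZl f X Z : g (f *: X) Z = f * g X Z.
Proof. by have := metric_linear gm f X 0 Z; rewrite addr0 metric0l addr0. Qed.
Lemma metricNl X Z : g (- X) Z = - g X Z.
Proof. by rewrite -scaleN1r metricZl mulN1r. Qed.
Lemma metricDr X Y Z : g Z (X + Y) = g Z X + g Z Y.
Proof. by rewrite !(Defs.metric_sym gm Z) metricDl. Qed.
Lemma metric0r Z : g Z 0 = 0.
Proof. by rewrite (Defs.metric_sym gm) metric0l. Qed.
Lemma metricZr f X Z : g Z (f *: X) = f * g Z X.
Proof. by rewrite !(Defs.metric_sym gm Z) metricZl. Qed.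
Lemma metricNr X Z : g Z (- X) = - g Z X.
Proof. by rewrite !(Defs.metric_sym gm Z) metricNl. Qed.

Definition metricE :=
  (metricDl, metricNl, metricZl, metricDr, metricNr, metricZr, metric0l, metric0r).

(** The difference [X - Y] has zero square norm, so by pointwise positivity it kills every function
    at every point. *)
Lemma metric_nondegenerate X Y : (forall Z, g X Z = g Y Z) -> X = Y.
Proof.
move=> gXY; apply/eqP; rewrite -subr_eq0; apply/eqP.
have gD : g (X - Y) (X - Y) = 0 by rewrite metricDl metricNl gXY subrr.
suff Dh h p : ((X - Y) h : C^oo(M)) p = 0.
  by apply: val_inj; apply/funext => h; apply: smooth_ext => p; rewrite Dh.
apply/eqP; apply: contraT => Dhp.
have := metric_pos gm (ex_intro _ h Dhp).
by rewrite gD [X in _ < X -> _]/(0 : R) ltxx.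
Qed.

End Metric.

(** * Algebra of an affine connection *)

Section Connection.
Context {R : realType} {n : nat} {M : manifold R n}.
Variable nabla : vector_field M -> vector_field M -> vector_field M.
Hypothesis cn : affine_connection nabla.
Implicit Types (f : C^oo(M)) (X Y Z : vector_field M).

Lemma nabla0r X : nabla X 0 = 0.
Proof. by apply: (@addrI _ (nabla X 0)); rewrite -(connection_additive cn) !addr0. Qed.

Lemma nabla0l X : nabla 0 X = 0.
Proof.
have := connection_linear cn 1 0 0 X; rewrite scale1r addr0 scale1r => h.
by apply: (@addrI _ (nabla 0 X)); rewrite -h addr0.
Qed.

Lemma nablaNr X Y : nabla X (- Y) = - nabla X Y.
Proof. by apply: (@addIr _ (nabla X Y)); rewrite -(connection_additive cn) !addNr nabla0r. Qed.

Lemma nablaZl f X Z : nabla (f *: X) Z = f *: nabla X Z.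
Proof. by have := connection_linear cn f X 0 Z; rewrite nabla0l !addr0. Qed.

End Connection.

(** * First and second covariant derivatives of [xi] *)

Section TransSasakian.
Context {R : realType} {n : nat} {M : manifold R n}.
Variables (phi : {linear vector_field M -> vector_field M}).
Variables (xi : vector_field M) (eta : {linear vector_field M -> C^oo(M)^o}).
Variable g : vector_field M -> vector_field M -> C^oo(M).
Variable nabla : vector_field M -> vector_field M -> vector_field M.
Variables alpha beta : C^oo(M).
Hypothesis acm : almost_contact_metric phi xi eta g.
Hypothesis lc : levi_civita g nabla.
Hypothesis ts : trans_sasakian phi xi eta g nabla alpha beta.
Implicit Types X Y : vector_field M.

Let gm := acm_metric acm.
Let cn := levi_civita_connection lc.

(** Compatibility at [Y = xi]: the left-hand side vanishes because [phi xi = 0]. *)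
Lemma eta_metric X : eta X = g X xi.
Proof.
have := acm_compatible acm X xi.
rewrite (acm_phi_xi acm) (metric0r gm) (acm_eta_xi acm) mulr1 => h.
by apply/esym/eqP; rewrite -subr_eq0 -h.
Qed.

Lemma metric_phi_xi X : g (phi X) xi = 0.
Proof. by rewrite -eta_metric (acm_eta_phi acm). Qed.

Lemma metric_xi_xi : g xi xi = 1.
Proof. by rewrite -eta_metric (acm_eta_xi acm). Qed.

(** Compatibility at [Y = phi X], together with the formula for [phi (phi X)], makes this function
    equal to its own opposite. *)
Lemma metric_phi_self X : g X (phi X) = 0.
Proof.
apply: smooth_addff_eq0; have := acm_compatible acm X (phi X).
rewrite (acm_phi2 acm) (acm_eta_phi acm) mulr0 subr0 !(metricE gm).
rewrite metric_phi_xi mulr0 addr0 (Defs.metric_sym gm (phi X)) => h.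
by rewrite -[X in X + _]h addNr.
Qed.

Lemma metric_nabla_xi X : g (nabla X xi) xi = 0.
Proof.
apply: smooth_addff_eq0; rewrite [X in _ + X](Defs.metric_sym gm).
by rewrite -(levi_civita_metric lc) metric_xi_xi vf1.
Qed.

(** At [Y = xi] the trans-Sasakian identity gives [- phi (nabla X xi)]. A second [phi] recovers
    [nabla X xi], which is orthogonal to [xi] because [xi] has unit length. *)
Lemma nabla_xi X :
  nabla X xi = beta *: (X - g X xi *: xi) - alpha *: phi X.
Proof.
have /(congr1 phi) := ts X xi.
rewrite (acm_phi_xi acm) (nabla0r cn) sub0r linearN /= (acm_phi2 acm).
rewrite eta_metric metric_nabla_xi scale0r addr0 opprK => ->.
rewrite metric_phi_xi (acm_eta_xi acm) !scale1r scale0r sub0r.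
rewrite linearD !linearZ /= linearB linearN !linearZ /= (acm_phi_xi acm).
by rewrite (acm_phi2 acm) scaler0 sub0r scalerN opprD opprK eta_metric addrC.
Qed.

Lemma nabla_xi_xi : nabla xi xi = 0.
Proof.
by rewrite nabla_xi metric_xi_xi scale1r subrr (acm_phi_xi acm) !scaler0 subr0.
Qed.

(** Of [nabla X X] only the [xi]-component has to be known: the remaining occurrences of [nabla X X]
    and [phi (nabla X X)] cancel between the two terms. *)
Lemma hessian_xi X : g X X = 1 -> g X xi = 0 ->
  nabla X (nabla X xi) - nabla (nabla X X) xi =
  (X beta : C^oo(M)) *: X - (X alpha : C^oo(M)) *: phi X
  - (alpha ^+ 2 + beta ^+ 2) *: xi.
Proof.
move=> gXX gXxi.
have nX : nabla X xi = beta *: X - alpha *: phi X.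
  by rewrite nabla_xi gXxi scale0r subr0.
have nphi : nabla X (phi X) = phi (nabla X X) + alpha *: xi.
  have := ts X X; rewrite eta_metric gXX gXxi !scale0r !subr0 scale1r.
  rewrite (Defs.metric_sym gm) metric_phi_self scale0r scaler0 addr0 => <-.
  by rewrite addrC subrK.
(* Differentiate [g X xi = 0] along [X]. *)
have gN : g (nabla X X) xi = - beta.
  have := levi_civita_metric lc X X xi; rewrite gXxi nX !(metricE gm) gXX.
  rewrite metric_phi_self mulr0 subr0 mulr1 => h.
  by apply/eqP; rewrite -addr_eq0 -h vf0.
rewrite nX (connection_additive cn) (nablaNr cn) !(connection_leibniz cn) nphi.
rewrite [nabla (nabla X X) xi]nabla_xi gN.
apply: (metric_nondegenerate gm) => Z; rewrite !(metricE gm).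
ring.
Qed.

End TransSasakian.

(** * The Newman-Penrose frame in dimension three *)

Section NewmanPenroseFrame.
Context {R : realType} {M : manifold R 3}.
Implicit Types X Y : vector_field M.

Definition inv_sqrt2 : C^oo(M) := smooth_cst M (Num.sqrt 2)^-1.

Lemma inv_sqrt2_sqr : 2 * (inv_sqrt2 * inv_sqrt2) = 1.
Proof.
have h : (Num.sqrt 2)^-1 * (Num.sqrt 2)^-1 = 2^-1 :> R.
  by rewrite -invfM -expr2 sqr_sqrtr.
rewrite smooth_cstM h mulr_natl mulr2n; apply: smooth_ext => p.
by have := splitr (1 : R); rewrite !div1r => /esym.
Qed.

Lemma np_delE (e1 e2 : vector_field M) :
  np_del e1 e2 = (inv_sqrt2 *: e1, - (inv_sqrt2 *: e2)).
Proof.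
congr pair => /=.
  by rewrite !(scale0r, scaler0, subr0).
by rewrite !(scale0r, scale1r, scaler0, sub0r, add0r, addr0) scalerN.
Qed.

Lemma np_delbarE (e1 e2 : vector_field M) :
  np_delbar e1 e2 = (inv_sqrt2 *: e1, inv_sqrt2 *: e2).
Proof.
by congr pair; rewrite /= !(scale0r, scale1r, scaler0, subr0, add0r, addr0).
Qed.

Lemma inv_sqrt2_scaleI X Y : inv_sqrt2 *: X = inv_sqrt2 *: Y -> X = Y.
Proof.
move=> /(congr1 (fun Z => 2 *: (inv_sqrt2 *: Z))).
by rewrite !scalerA -!mulrA inv_sqrt2_sqr !scale1r.
Qed.

(** Compare real and imaginary parts in [np_phi_del] and cancel the factor [inv_sqrt2]. *)
Lemma np_frame_phi phi xi g (e1 e2 : vector_field M) : np_frame phi xi g e1 e2 ->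
  phi e1 = e2 /\ phi e2 = - e1.
Proof.
move=> np; have := np_phi_del np; rewrite np_delE => -[].
rewrite linearN !linearZ /= !scale0r !scale1r !scaler0 !add0r opprK linearN /=.
move=> h1 h2.
split; first exact: inv_sqrt2_scaleI.
by apply: inv_sqrt2_scaleI; rewrite scalerN -h2 scalerN opprK.
Qed.

Lemma np_frame_metric phi xi g (e1 e2 : vector_field M) : np_frame phi xi g e1 e2 ->
  [/\ g e1 e1 = 1, g e2 e2 = 1, g e1 e2 = 0, g e1 xi = 0 & g e2 xi = 0].
Proof.
move=> /np_orthonormal[_ on]; split.
- exact: (on ord0 ord0).
- exact: (on (@Ordinal 3 1 isT) (@Ordinal 3 1 isT)).
- exact: (on ord0 (@Ordinal 3 1 isT)).
- exact: (on ord0 (@Ordinal 3 2 isT)).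
- exact: (on (@Ordinal 3 1 isT) (@Ordinal 3 2 isT)).
Qed.

Section TransSasakian3.
Variables (phi : {linear vector_field M -> vector_field M}).
Variables (xi : vector_field M) (eta : {linear vector_field M -> C^oo(M)^o}).
Variable g : vector_field M -> vector_field M -> C^oo(M).
Variable nabla : vector_field M -> vector_field M -> vector_field M.
Variables (alpha beta : C^oo(M)) (e1 e2 : vector_field M).
Hypothesis acm : almost_contact_metric phi xi eta g.
Hypothesis lc : levi_civita g nabla.
Hypothesis ts : trans_sasakian phi xi eta g nabla alpha beta.
Hypothesis np : np_frame phi xi g e1 e2.

Let gm := acm_metric acm.
Let cn := levi_civita_connection lc.

Lemma np_rhoE : np_rho g nabla e1 e2 xi = (beta, alpha).
Proof.
have [g11 g22 g12 g1 g2] := np_frame_metric np.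
have [p1 p2] := np_frame_phi np.
have g21 : g e2 e1 = 0 by rewrite (Defs.metric_sym gm).
rewrite /np_rho np_delE np_delbarE /cplx_ext2 /= !(nabla0r cn) subr0 add0r.
rewrite !(nablaZl cn) !(nabla_xi acm lc ts) p1 p2 g1 g2 !scale0r !subr0.
rewrite !(metricE gm) g11 g22 g12 g21.
(* For [ring], [inv_sqrt2] is an atom, so its square is made visible on the right as well. *)
rewrite -[beta in RHS]mul1r -[alpha in RHS]mul1r -[1 in RHS]inv_sqrt2_sqr.
by congr pair; ring.
Qed.

(** Since [phi] rotates [e1] to [e2] and [e2] to [- e1], the derivatives of [alpha] along one frame
    vector land on the other. *)
Lemma rough_laplacian_xi :
  rough_laplacian nabla (frame3 e1 e2 xi) xi =
  - ((e1 beta : C^oo(M)) + (e2 alpha : C^oo(M))) *: e1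
  - ((e2 beta : C^oo(M)) - (e1 alpha : C^oo(M))) *: e2
  + (2 * (alpha ^+ 2 + beta ^+ 2)) *: xi.
Proof.
have [g11 g22 g12 g1 g2] := np_frame_metric np.
have [p1 p2] := np_frame_phi np.
rewrite /rough_laplacian !big_ord_recl big_ord0 /frame3 /=.
rewrite (hessian_xi acm lc ts g11 g1) (hessian_xi acm lc ts g22 g2) p1 p2.
rewrite (nabla_xi_xi acm lc ts) (nabla0r cn) (nabla0l cn).
by apply: (metric_nondegenerate gm) => Z; rewrite !(metricE gm); ring.
Qed.

End TransSasakian3.

End NewmanPenroseFrame.

Theorem theorem5p3 (R : realType) (M : manifold R 3)
    (phi : {linear vector_field M -> vector_field M})
    (xi : vector_field M)
    (eta : {linear vector_field M -> C^oo(M)^o})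
    (g : vector_field M -> vector_field M -> C^oo(M))
    (nabla : vector_field M -> vector_field M -> vector_field M)
    (alpha beta : C^oo(M))
    (e1 e2 : vector_field M)
    (acm : almost_contact_metric phi xi eta g)
    (lc : levi_civita g nabla)
    (ts : trans_sasakian phi xi eta g nabla alpha beta)
    (np : np_frame phi xi g e1 e2) :
  let d := np_del e1 e2 in
  let dbar := np_delbar e1 e2 in
  let rho := np_rho g nabla e1 e2 xi in
  cplx_of (rough_laplacian nabla (frame3 e1 e2 xi) xi) =
    - cplx_derive dbar (cplx_conj rho) *: d
    - cplx_derive d rho *: dbar
    + cplx_of (2 * cplx_normsq rho) *: cplx_of xi.
Proof.
move=> d dbar rho; rewrite (rough_laplacian_xi acm lc ts np).
have rhoE : rho = (beta, alpha) := np_rhoE acm lc ts np.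
(* Up to the factor [inv_sqrt2], [A + iB] is the derivative of the conjugate of [rho] along [dbar],
   and [A - iB] that of [rho] along [d]. *)
pose A : C^oo(M) := (e1 beta : C^oo(M)) + (e2 alpha : C^oo(M)).
pose B : C^oo(M) := (e2 beta : C^oo(M)) - (e1 alpha : C^oo(M)).
have D1 : cplx_derive dbar (cplx_conj rho) = (inv_sqrt2 * A, inv_sqrt2 * B).
  rewrite rhoE /dbar np_delbarE cplx_deriveE !vfN !vfZl.
  by congr pair; rewrite /A /B; ring.
have D2 : cplx_derive d rho = (inv_sqrt2 * A, - (inv_sqrt2 * B)).
  rewrite rhoE /d np_delE cplx_deriveE !vfNl !vfZl.
  by congr pair; rewrite /A /B; ring.
have half (f : C^oo(M)) : f = 2 * (inv_sqrt2 * inv_sqrt2) * f.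
  by rewrite inv_sqrt2_sqr mul1r.
have gm := acm_metric acm.
rewrite D1 D2 /d /dbar np_delE np_delbarE rhoE /cplx_normsq -/A -/B.
(* The first two terms on the right are conjugate to each other, so the imaginary parts cancel and
   the real parts double; [half] absorbs that 2 into the square of [inv_sqrt2]. *)
congr pair; apply: (metric_nondegenerate gm) => Z; rewrite /= !(metricE gm).
- by rewrite [A in LHS]half [B in LHS]half; ring.
- by ring.
Qed.
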